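(* Let $n\ge 4$ and let $u_1(x,t)=(-(n+1)t)^{\frac1{n+1}}\varphi(|x|)$, $(x,t)\in\mathbb R^n\times(-\infty,0]$, be the parabolically convex solution of $-u_t\det D^2u=1$ defined in the context. Then there exists a constant $K_n>0$ depending only on $n$ such that \[ \varphi(r)=\frac{n+1}{(2n)^{\frac{n}{n+1}}(n-1)^{\frac1{n+1}}}\,r^{\frac{2n}{n+1}}+O(r^{-K_n})\quad\text{as }r\to\infty . \] Furthermore, $K_n$ can be given explicitly as \[ K_n=\begin{cases} \dfrac{n(n-3)}{2(n+1)}, & n=4,5,\\[3mm] \dfrac{n}{n+1}\left(\dfrac{n-3}{2}-\sqrt{\dfrac{(n-3)^2}{4}-\dfrac{2(n-1)}{n}}\right), & n\ge 6. \end{cases} \]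
   Context: Here $\varphi\in C^2([0,\infty))$ is the unique monotone non-decreasing solution of \[ (\varphi'(r))^n=n\int_0^r\frac{s^{n-1}}{\varphi(s)}\,\mathrm ds\quad (r>0),\qquad \varphi(0)=1, \] equivalently of $\varphi\,(\varphi')^{n-1}\varphi''=r^{n-1}$ for $r>0$, $\varphi'(0)=0$, $\varphi(0)=1$. A function on $\mathbb R^n\times(-\infty,0]$ is called parabolically convex if it is continuous, convex in $x$ and non-increasing in $t$. *)

(* Defs.v *)
From Stdlib Require Import Reals.
From Coquelicot Require Import Coquelicot.
Open Scope R_scope.

Definition halfline (r : R) : Prop := 0 <= r.

(* [f] is C^2 on [0,oo) with first and second derivatives [f1] and [f2].
   [D_in] and [continue_in] are relative to [0,oo), hence one-sided at 0:
   the values of [f], [f1], [f2] at negative arguments play no role. *)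
Definition C2_halfline (f f1 f2 : R -> R) : Prop :=
  forall r, 0 <= r ->
    D_in f f1 halfline r /\ D_in f1 f2 halfline r /\ continue_in f2 halfline r.

(* phi is the radial profile of the parabolically convex solution
   u(x,t) = (-(n+1)t)^(1/(n+1)) phi(|x|) of - u_t det D^2 u = 1 on
   R^n x (-oo,0].  The integrand is Riemann integrable, since phi is
   continuous and >= 1 on [0,oo), so [RInt] is not a default value. *)
Definition radial_profile (n : nat) (phi : R -> R) : Prop :=
  phi 0 = 1 /\
  (forall r s, 0 <= r -> r <= s -> phi r <= phi s) /\
  exists phi1 phi2 : R -> R,
    C2_halfline phi phi1 phi2 /\
    forall r, 0 < r ->
      phi1 r ^ n = INR n * RInt (fun s => s ^ (n - 1) / phi s) 0 r.

Definition bigO_at_infty (f g : R -> R) : Prop :=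
  exists C : R, Rbar_locally p_infty (fun r => Rabs (f r) <= C * Rabs (g r)).

Definition leading_coef (n : nat) : R :=
  (INR n + 1) /
  (Rpower (2 * INR n) (INR n / (INR n + 1)) *
   Rpower (INR n - 1) (1 / (INR n + 1))).

(* Only meant for n >= 4, so that the first branch is n = 4, 5. *)
Definition decay_exponent (n : nat) : R :=
  if Nat.leb n 5 then
    INR n * (INR n - 3) / (2 * (INR n + 1))
  else
    INR n / (INR n + 1) *
    ((INR n - 3) / 2 -
     sqrt ((INR n - 3) ^ 2 / 4 - 2 * (INR n - 1) / INR n)).

(* Main.v *)
Require Import Defs.
From Stdlib Require Import Reals Lra Lia.
From Coquelicot Require Import Coquelicot.
Open Scope R_scope.

(** Put [al = 2n/(n+1)] ([growth n]) and [s = ln r], and measure the solution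
against the exact power solution [c r^al] in logarithmic variables:
[phi = c r^al e^a], [phi' = c al r^(al-1) e^b].  The radial equation
[phi phi'^(n-1) phi'' = r^(n-1)] becomes the autonomous planar system
[log_profile_system]
<<
   a' = al (e^(b-a) - 1),      b' = (al-1) (e^(-a-nb) - 1),
>>
whose only equilibrium is the origin, and the theorem is a statement about
the rate at which one orbit, defined for all [s], reaches it.

Global convergence.  In the variables [x = e^a], [z = e^(nb)] the system is a
negative feedback loop with damping ([x' = al (z^(1/n) - x)],
[z' = n (al-1) (1/x - z)]), and such a loop has the Lyapunov function obtained by
adding the primitives of the two coupling terms: the couplings cancel and the
damping gives the decay.  Convexity bounds each summand of this [entropy] by
its own dissipation, whatever the size of [a] and [b], so the entropy decays
at least like [e^(-al s)] along every orbit ([entropy_dissipation]).  Hence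
[a, b = O(e^(-al s/2))] ([log_profile_exp_decay]).

Sharp rate.  With [d = al (b-a)] the linear part of the system is the damped
oscillator [a'' + n a' + k a = 0], [k = 2n(n-1)/(n+1)], with characteristic roots
[-n/2 +- sqrt (n^2/4 - k)]: complex for [n = 4, 5], real and distinct for
[n >= 6].  They never coincide since [n^2 - 7n + 8] has no integer zero, so there
is no Jordan block and a quadratic form decays exactly at the slow rate
([adapted_quadratic_form]).  The remainder is quadratic and, by the first step,
is the linear term times an integrable factor; Gronwall's inequality
([perturbed_gronwall]) then loses nothing in the exponent
([damped_oscillator_decay]).  So [a = O(e^(-lam s))] with
[lam = n/2 - sqrt (n^2/4 - k)], where the square root reads as [0] when [n <= 5],
and [phi - c r^al = c r^al (e^a - 1) = O(r^(al - lam))]; the exponent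
[lam - al] is the announced one ([decay_exponent_eq]). *)

(** * Differential inequalities *)

Lemma nonincreasing_of_derive (f df : R -> R) (s0 : R) :
  (forall s, s0 <= s -> is_derive f s (df s)) ->
  (forall s, s0 <= s -> df s <= 0) ->
  forall s, s0 <= s -> f s <= f s0.
Proof.
intros Hd Hle s Hs.
destruct (MVT_gen f s0 s df) as [c [Hc Heq]].
- intros x Hx. apply Hd. rewrite Rmin_left in Hx by lra. lra.
- intros x Hx. rewrite Rmin_left in Hx by lra.
  apply continuity_pt_filterlim.
  apply (ex_derive_continuous f x). exists (df x). apply Hd. lra.
- rewrite Rmin_left in Hc by lra.
  assert (Hc' := Hle c (proj1 Hc)). nra.
Qed.

(** The perturbation of the rate is integrable over the half-line, so it costs
only a constant factor and leaves the exponent [lam] intact. *)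
Lemma perturbed_gronwall (W dW : R -> R) (lam C mu s0 : R) :
  0 <= C -> 0 < mu ->
  (forall s, s0 <= s -> is_derive W s (dW s)) ->
  (forall s, s0 <= s -> 0 <= W s) ->
  (forall s, s0 <= s -> dW s <= (- lam + C * exp (- (mu * s))) * W s) ->
  exists M, 0 <= M /\ forall s, s0 <= s -> W s <= M * exp (- (lam * s)).
Proof.
intros HC Hmu HW Hpos Hle.
(* [W e^g] is non-increasing, because [g' = lam - C e^(-mu s)]. *)
pose (g := fun s => lam * s + C / mu * exp (- (mu * s))).
exists (W s0 * exp (g s0)). split.
{ apply Rmult_le_pos. apply Hpos; lra. left; apply exp_pos. }
intros s Hs.
assert (H : W s * exp (g s) <= W s0 * exp (g s0)).
{ apply (nonincreasing_of_derive (fun t => W t * exp (g t))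
    (fun t => (dW t + (lam - C * exp (- (mu * t))) * W t) * exp (g t)) s0); trivial.
  - intros t Ht. unfold g.
    assert (Ht' := HW t Ht).
    auto_derive.
    + exists (dW t); exact Ht'.
    + replace (Derive (fun x => W x) t) with (dW t).
      field; lra. symmetry; apply is_derive_unique; exact Ht'.
  - intros t Ht. assert (H := Hle t Ht).
    assert (He := exp_pos (g t)). nra. }
assert (Hg : exp (lam * s) <= exp (g s)).
{ destruct (Req_dec (lam * s) (g s)) as [E|E]; [rewrite E; lra|].
  left. apply exp_increasing. unfold g in *.
  assert (0 <= C / mu * exp (- (mu * s))); [|lra].
  apply Rmult_le_pos. apply Rdiv_le_0_compat; lra. left; apply exp_pos. }
assert (HWs := Hpos s Hs).
rewrite exp_Ropp.
assert (Hp := exp_pos (lam * s)).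
apply Rmult_le_reg_r with (exp (lam * s)); trivial.
rewrite Rmult_assoc, Rinv_l, Rmult_1_r by lra.
apply Rle_trans with (2 := H).
apply Rmult_le_compat_l; trivial.
Qed.

Lemma eventually_exp_decay_le (M al eps : R) :
  0 <= M -> 0 < al -> 0 < eps ->
  exists s0, forall s, s0 <= s -> M * exp (- (al * s)) <= eps.
Proof.
intros HM Hal He.
(* From [e^(al s) >= al s]. *)
exists (M / (al * eps)). intros s Hs.
rewrite exp_Ropp.
assert (Hp := exp_pos (al * s)).
assert (H1 := exp_ineq1_le (al * s)).
apply Rmult_le_reg_r with (exp (al * s)); trivial.
rewrite Rmult_assoc, Rinv_l, Rmult_1_r by lra.
assert (H2 : M <= eps * (al * s)).
{ apply Rmult_le_compat_l with (r := al * eps) in Hs; [|nra].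
  replace (al * eps * (M / (al * eps))) with M in Hs by (field; lra). lra. }
nra.
Qed.

(** * Damped oscillators with a small perturbation *)

(** The smallest real part of a root of [X^2 - n X + k].  Since [sqrt] vanishes on
negative numbers, this also gives the common real part [n/2] of two complex
conjugate roots. *)
Definition slow_rate (n k : R) : R := n / 2 - sqrt (n ^ 2 / 4 - k).

(** The linear system [a' = d], [d' = - k a - n d] contracts a suitable positive
definite form at the full spectral rate.  This needs distinct roots: at a double
root the solutions carry a factor [s]. *)
Lemma adapted_quadratic_form (n k : R) :
  n ^ 2 <> 4 * k ->
  exists P Q S kap, 0 < kap /\
    forall a d,
      kap * (a ^ 2 + d ^ 2) <= P * a ^ 2 + 2 * Q * a * d + S * d ^ 2 /\
      (2 * P * a + 2 * Q * d) * d + (2 * Q * a + 2 * S * d) * (- k * a - n * d)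
      <= - (2 * slow_rate n k) * (P * a ^ 2 + 2 * Q * a * d + S * d ^ 2).
Proof.
intros Hk.
(* A positive form is bounded below by determinant over trace. *)
assert (Hdef : forall P Q S, 0 < P + S -> 0 < P * S - Q ^ 2 ->
  0 < (P * S - Q ^ 2) / (P + S) /\
  forall a d, (P * S - Q ^ 2) / (P + S) * (a ^ 2 + d ^ 2)
     <= P * a ^ 2 + 2 * Q * a * d + S * d ^ 2).
{ intros P Q S HPS HD. split; [apply Rdiv_lt_0_compat; lra|].
  intros a d.
  apply Rmult_le_reg_l with (P + S); trivial.
  replace ((P + S) * ((P * S - Q ^ 2) / (P + S) * (a ^ 2 + d ^ 2)))
    with ((P * S - Q ^ 2) * (a ^ 2 + d ^ 2)) by (field; lra).
  assert (0 <= (P * a + Q * d) ^ 2 + (Q * a + S * d) ^ 2) by (apply Rplus_le_le_0_compat; apply pow2_ge_0).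
  lra. }
unfold slow_rate.
destruct (Rlt_dec (n ^ 2) (4 * k)) as [Hlt|Hge].
(* Complex roots: the modulus squared [(d + n a/2)^2 + (k - n^2/4) a^2] of the
   complex eigencoordinate, which satisfies [W' = - n W]. *)
- rewrite sqrt_neg_0 by lra.
  exists k, (n / 2), 1, ((k * 1 - (n / 2) ^ 2) / (k + 1)).
  assert (Hn2 : 0 <= n ^ 2) by apply pow2_ge_0.
  destruct (Hdef k (n / 2) 1) as [H1 H2]; [lra|lra|].
  split; trivial. intros a d. split; [apply H2|]. nra.
(* Real roots [l1 < l2]: the sum [(d + l2 a)^2 + (d + l1 a)^2] of the squared
   eigencoordinates; [W' + 2 l1 W = - 2 (l2 - l1) (d + l1 a)^2]. *)
- assert (Hsq : sqrt (n ^ 2 / 4 - k) ^ 2 = n ^ 2 / 4 - k) by (apply pow2_sqrt; lra).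
  assert (Hs0 := sqrt_pos (n ^ 2 / 4 - k)).
  set (w := sqrt (n ^ 2 / 4 - k)) in *.
  exists (n ^ 2 - 2 * k), n, 2, (((n ^ 2 - 2 * k) * 2 - n ^ 2) / (n ^ 2 - 2 * k + 2)).
  assert (Hn2 : 0 <= n ^ 2) by apply pow2_ge_0.
  destruct (Hdef (n ^ 2 - 2 * k) n 2) as [H1 H2]; [lra|lra|].
  split; trivial. intros a d. split; [apply H2|].
  replace k with (n ^ 2 / 4 - w ^ 2) by lra.
  assert (0 <= w * (d + (n / 2 - w) * a) ^ 2) by (apply Rmult_le_pos; [|apply pow2_ge_0]; trivial).
  lra.
Qed.

(** The adapted form [W] satisfies
[W' <= (- 2 slow_rate + const e^(-mu s)) W], since the error terms pair with the
gradient of [W] into a quadratic expression in [a, d]. *)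
Lemma damped_oscillator_decay (n k C mu s0 : R) (a d E1 E2 : R -> R) :
  n ^ 2 <> 4 * k -> 0 <= C -> 0 < mu ->
  (forall s, s0 <= s -> is_derive a s (d s + E1 s)) ->
  (forall s, s0 <= s -> is_derive d s (- k * a s - n * d s + E2 s)) ->
  (forall s, s0 <= s -> Rabs (E1 s) <= C * exp (- (mu * s)) * (Rabs (a s) + Rabs (d s))) ->
  (forall s, s0 <= s -> Rabs (E2 s) <= C * exp (- (mu * s)) * (Rabs (a s) + Rabs (d s))) ->
  exists M, 0 <= M /\
    forall s, s0 <= s -> a s ^ 2 <= M * exp (- (2 * slow_rate n k * s)).
Proof.
intros Hnk HC Hmu Ha Hd HE1 HE2.
destruct (adapted_quadratic_form n k Hnk) as [P [Q [S [kap [Hkap Hform]]]]].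
pose (W := fun s => P * a s ^ 2 + 2 * Q * a s * d s + S * d s ^ 2).
pose (B := Rabs P + 2 * Rabs Q + Rabs S).
assert (HP := Rabs_pos P). assert (HQ := Rabs_pos Q). assert (HS := Rabs_pos S).
assert (HB : 0 <= B) by (unfold B; lra).
destruct (perturbed_gronwall W
  (fun s => (2 * P * a s + 2 * Q * d s) * (d s + E1 s)
            + (2 * Q * a s + 2 * S * d s) * (- k * a s - n * d s + E2 s))
  (2 * slow_rate n k) (4 * B * C / kap) mu s0) as [M [HM HW]]; trivial.
- apply Rdiv_le_0_compat; nra.
- intros s Hs. unfold W.
  assert (Has := Ha s Hs). assert (Hds := Hd s Hs).
  auto_derive.
  + split; [eexists; exact Has|]. split; [eexists; exact Has|].
    split; [eexists; exact Hds|]. split; [eexists; exact Hds|trivial].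
  + replace (Derive (fun x => a x) s) with (d s + E1 s)
      by (symmetry; apply is_derive_unique; exact Has).
    replace (Derive (fun x => d x) s) with (- k * a s - n * d s + E2 s)
      by (symmetry; apply is_derive_unique; exact Hds).
    ring.
- intros s Hs. unfold W. destruct (Hform (a s) (d s)) as [H _].
  apply Rle_trans with (2 := H). apply Rmult_le_pos; [lra|].
  apply Rplus_le_le_0_compat; apply pow2_ge_0.
- intros s Hs. unfold W.
  destruct (Hform (a s) (d s)) as [Hlow Hlin].
  assert (H1 := HE1 s Hs). assert (H2 := HE2 s Hs).
  set (x := a s) in *. set (y := d s) in *. set (e := exp (- (mu * s))) in *.
  assert (He : 0 < e) by apply exp_pos.
  set (N := Rabs x + Rabs y) in *.
  assert (HN : N ^ 2 <= 2 * (x ^ 2 + y ^ 2)).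
  { unfold N. rewrite <- (pow2_abs x), <- (pow2_abs y).
    assert (H := pow2_ge_0 (Rabs x - Rabs y)). lra. }
  assert (Hx := Rabs_pos x). assert (Hy := Rabs_pos y).
  assert (Hlc : forall p q E, Rabs E <= C * e * N ->
     (p * x + q * y) * E <= (Rabs p + Rabs q) * (C * e * N ^ 2)).
  { intros p q E HE.
    apply Rle_trans with (1 := Rle_abs _). rewrite Rabs_mult.
    apply Rle_trans with (((Rabs p + Rabs q) * N) * (C * e * N)).
    - apply Rmult_le_compat; try apply Rabs_pos; trivial.
      apply Rle_trans with (1 := Rabs_triang _ _). rewrite !Rabs_mult.
      assert (Hp := Rabs_pos p). assert (Hq := Rabs_pos q). unfold N. nra.
    - right; ring. }
  assert (K1 := Hlc (2 * P) (2 * Q) (E1 s) H1).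
  assert (K2 := Hlc (2 * Q) (2 * S) (E2 s) H2).
  rewrite !Rabs_mult in K1, K2. rewrite (Rabs_right 2) in K1, K2 by lra.
  assert (K3 : 2 * B * (C * e * N ^ 2)
     <= 4 * B * C / kap * e * (P * x ^ 2 + 2 * Q * x * y + S * y ^ 2)).
  { apply Rle_trans with (4 * B * C / kap * e * (kap * (x ^ 2 + y ^ 2))).
    - replace (4 * B * C / kap * e * (kap * (x ^ 2 + y ^ 2)))
        with (2 * B * (C * e) * (2 * (x ^ 2 + y ^ 2))) by (field; lra).
      rewrite <- (Rmult_assoc (2 * B)).
      apply Rmult_le_compat_l; trivial.
      repeat apply Rmult_le_pos; lra.
    - apply Rmult_le_compat_l; trivial.
      apply Rmult_le_pos; [|lra]. apply Rdiv_le_0_compat; trivial.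
      repeat apply Rmult_le_pos; lra. }
  unfold B in *. lra.
- exists (M / kap). split; [apply Rdiv_le_0_compat; lra|].
  intros s Hs. destruct (Hform (a s) (d s)) as [Hlow _].
  assert (H := HW s Hs). unfold W in H.
  apply Rmult_le_reg_l with kap; trivial.
  replace (kap * (M / kap * exp (- (2 * slow_rate n k * s))))
    with (M * exp (- (2 * slow_rate n k * s))) by (field; lra).
  assert (0 <= kap * d s ^ 2) by (apply Rmult_le_pos; [lra|apply pow2_ge_0]).
  lra.
Qed.

(** * Convexity inequalities *)

Lemma exp_taylor1_error (u : R) : Rabs u <= 1 / 2 -> Rabs (exp u - 1 - u) <= 2 * u ^ 2.
Proof.
intros Hu. apply Rabs_le_between in Hu.
assert (H1 := exp_ineq1_le u). assert (H2 := exp_ineq1_le (- u)).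
rewrite exp_Ropp in H2. assert (Hp := exp_pos u).
assert (H3 : (1 - u) * exp u <= 1).
{ apply Rmult_le_compat_r with (r := exp u) in H2; [|lra].
  rewrite Rinv_l in H2 by lra. lra. }
apply Rabs_le. split; [nra|].
nra.
Qed.

(** The hypothesis keeps [e^h] above [1/2], where the logarithm is
2-Lipschitz. *)
Lemma sq_le_of_exp_near_1 (h : R) :
  (exp h - 1) ^ 2 <= 1 / 4 -> h ^ 2 <= 4 * (exp h - 1) ^ 2.
Proof.
intros H. assert (H1 := exp_ineq1_le h). assert (H2 := exp_ineq1_le (- h)).
assert (Hp := exp_pos h). rewrite exp_Ropp in H2.
assert (H3 : (1 - h) * exp h <= 1).
{ apply Rmult_le_compat_r with (r := exp h) in H2; [|lra].
  rewrite Rinv_l in H2 by lra. lra. }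
assert (Hhalf : 1 / 2 <= exp h) by nra.
destruct (Rle_dec 0 h) as [Hh|Hh]; nra.
Qed.

(** [e^a - 1 - a] is [(e^(a/2) - 1)^2 + 2 (e^(a/2) - 1 - a/2)],
and [e^h >= 1 + h]. *)
Lemma entropy_ge_sq (a : R) : (exp (a / 2) - 1) ^ 2 <= exp a - 1 - a.
Proof.
assert (H := exp_ineq1_le (a / 2)).
replace (exp a) with (exp (a / 2) ^ 2).
nra. simpl. rewrite Rmult_1_r, <- exp_plus. f_equal. field.
Qed.

Lemma bernoulli (y : R) (m : nat) : 0 <= y -> 1 + INR m * (y - 1) <= y ^ m.
Proof.
intros Hy. induction m as [|m IH].
- simpl. lra.
- rewrite S_INR. simpl.
  assert (Hm := pos_INR m).
  assert (H := Rmult_le_compat_l y _ _ Hy IH).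
  assert (0 <= INR m * (y - 1) ^ 2) by (apply Rmult_le_pos; [lra|apply pow2_ge_0]). lra.
Qed.

(** The right-hand side is [(y - 1)^2 (1 + 2 y + 3 y^2 + ... + m y^(m-1))]; the
induction adds the last term of the sum. *)
Lemma power_gap_ge_sq (y : R) (m : nat) : 0 <= y -> (1 <= m)%nat ->
  (y - 1) ^ 2 <= INR m * y ^ (S m) - (INR m + 1) * y ^ m + 1.
Proof.
intros Hy Hm. induction Hm as [|m Hm IH].
- simpl. nra.
- rewrite S_INR.
  assert (Hp := pow_le y m Hy). assert (Hi := pos_INR m).
  assert (0 <= (INR m + 1) * y ^ m * (y - 1) ^ 2).
  { apply Rmult_le_pos; [apply Rmult_le_pos; lra|apply pow2_ge_0]. }
  simpl in *. nra.
Qed.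

(** * The logarithmic system and its Lyapunov function *)

Definition growth (n : nat) : R := 2 * INR n / (INR n + 1).

Definition log_profile_system (n : nat) (a b : R -> R) : Prop :=
  forall s,
    is_derive a s (growth n * (exp (b s - a s) - 1)) /\
    is_derive b s ((growth n - 1) * (exp (- a s - INR n * b s) - 1)).

(** With [x = e^a], [y = e^b], [z = y^n] this is
[n (al-1)] times the primitive of [1 - 1/x] vanishing at [x = 1] plus [al] times the
primitive of [z^(1/n) - 1] vanishing at [z = 1]; the weights are those that make
the coupling terms cancel along the flow. *)
Definition entropy (n : nat) (a b : R) : R :=
  INR n * (growth n - 1) * (exp a - 1 - a) +
  growth n * (INR n / (INR n + 1) * (exp ((INR n + 1) * b) - 1)
              - (exp (INR n * b) - 1)).

Lemma growth_bounds (n : nat) : (4 <= n)%nat ->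
  4 <= INR n /\ 1 < growth n < 2 /\ growth n <= INR n * (growth n - 1).
Proof.
intros Hn. apply le_INR in Hn. replace (INR 4) with 4 in Hn by (simpl; lra).
assert (H1 : growth n = 1 + (INR n - 1) / (INR n + 1)) by (unfold growth; field; lra).
assert (H2 : growth n = 2 - 2 / (INR n + 1)) by (unfold growth; field; lra).
assert (H3 : INR n * (growth n - 1) - growth n = INR n * (INR n - 3) / (INR n + 1))
  by (unfold growth; field; lra).
assert (0 < (INR n - 1) / (INR n + 1)) by (apply Rdiv_lt_0_compat; lra).
assert (0 < 2 / (INR n + 1)) by (apply Rdiv_lt_0_compat; lra).
assert (0 <= INR n * (INR n - 3) / (INR n + 1)) by (apply Rdiv_le_0_compat; nra).
lra.
Qed.

Lemma exp_INR_mult (n : nat) (b : R) : exp (INR n * b) = exp b ^ n.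
Proof.
rewrite <- Rpower_pow by apply exp_pos. unfold Rpower. now rewrite ln_exp.
Qed.

Lemma exp_INR_S_mult (n : nat) (b : R) : exp ((INR n + 1) * b) = exp b ^ S n.
Proof. now rewrite <- S_INR, exp_INR_mult. Qed.

(** Along the flow the coupling terms [(x-1)(y-1)/x] cancel and the
derivative is [- al be ((x-1)^2/x + (y-1)(y^n-1))], [be = n (al-1)].  For a convex
function vanishing with its derivative at 1, [f <= f' * (argument - 1)], which bounds
each summand of the entropy by the corresponding term. *)
Lemma entropy_dissipation (n : nat) (a b : R -> R) (s : R) :
  (4 <= n)%nat -> log_profile_system n a b ->
  exists dV, is_derive (fun t => entropy n (a t) (b t)) s dV /\
    dV <= - growth n * entropy n (a s) (b s).
Proof.
intros Hn Hsys. destruct (growth_bounds n Hn) as [HN [Hal Hbe]].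
destruct (Hsys s) as [Ha Hb].
set (al := growth n) in *.
set (x := exp (a s)). set (y := exp (b s)).
assert (Hx : 0 < x) by apply exp_pos. assert (Hy : 0 < y) by apply exp_pos.
exists (- (al * (INR n * (al - 1)) * ((x - 1) ^ 2 / x + (y - 1) * (y ^ n - 1)))).
split.
- unfold entropy. fold al. auto_derive.
  + split; [eexists; exact Ha|]. split; [eexists; exact Ha|].
    split; [eexists; exact Hb|]. split; [eexists; exact Hb|trivial].
  + replace (Derive (fun x => a x) s) with (al * (exp (b s - a s) - 1))
      by (symmetry; apply is_derive_unique; exact Ha).
    replace (Derive (fun x => b x) s)
      with ((al - 1) * (exp (- a s - INR n * b s) - 1))
      by (symmetry; apply is_derive_unique; exact Hb).
    replace (exp (b s - a s)) with (y * / x)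
      by (unfold x, y; rewrite <- exp_Ropp, <- exp_plus; f_equal; ring).
    replace (exp (- a s - INR n * b s)) with (/ x * / y ^ n)
      by (unfold x, y; rewrite <- exp_INR_mult, <- !exp_Ropp, <- exp_plus; f_equal; ring).
    rewrite exp_INR_S_mult, exp_INR_mult. fold x y. simpl (y ^ S n).
    assert (y ^ n <> 0) by (apply pow_nonzero; lra).
    field. repeat split; trivial; lra.
(* [ln x >= 1 - 1/x] for the first summand, Bernoulli for the second; then the
   weights compare because [al <= n (al-1)]. *)
- assert (HF : x - 1 - a s <= (x - 1) ^ 2 / x).
  { assert (H := exp_ineq1_le (- a s)). rewrite exp_Ropp in H. fold x in H.
    replace ((x - 1) ^ 2 / x) with (x - 2 + / x) by (field; lra). lra. }
  assert (HF0 : 0 <= (x - 1) ^ 2 / x) by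
    (apply Rdiv_le_0_compat; [apply pow2_ge_0|trivial]).
  assert (HG : INR n / (INR n + 1) * (y ^ S n - 1) - (y ^ n - 1)
               <= (y - 1) * (y ^ n - 1)).
  { assert (H := bernoulli y (S n) (Rlt_le _ _ Hy)). rewrite S_INR in H.
    apply Rmult_le_reg_l with (INR n + 1); [lra|].
    replace ((INR n + 1) * (INR n / (INR n + 1) * (y ^ S n - 1) - (y ^ n - 1)))
      with (INR n * (y ^ S n - 1) - (INR n + 1) * (y ^ n - 1)) by (field; lra).
    simpl in *. lra. }
  unfold entropy. rewrite exp_INR_S_mult, exp_INR_mult. fold al x y.
  set (F := x - 1 - a s) in *. set (G := INR n / (INR n + 1) * (y ^ S n - 1) - (y ^ n - 1)) in *.
  set (F' := (x - 1) ^ 2 / x) in *. set (G' := (y - 1) * (y ^ n - 1)) in *.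
  set (be := INR n * (al - 1)) in *.
  assert (HG0 : 0 <= G').
  { unfold G'. destruct (Rle_dec 1 y).
    - assert (H := pow_R1_Rle y n r). apply Rmult_le_pos; lra.
    - assert (y ^ n <= 1) by (rewrite <- (pow1 n); apply pow_incr; lra).
      replace ((y - 1) * (y ^ n - 1)) with ((1 - y) * (1 - y ^ n)) by ring.
      apply Rmult_le_pos; lra. }
  assert (H1 : al * be * F <= al * be * F') by (apply Rmult_le_compat_l; nra).
  assert (H2 : al * al * G <= al * be * G').
  { apply Rle_trans with (al * al * G'); [apply Rmult_le_compat_l; nra|].
    apply Rmult_le_compat_r; nra. }
  lra.
Qed.

(** Coercivity: it turns the decay of the entropy into decay of [a] and
[b]. *)
Lemma entropy_ge_sqs (n : nat) (a b : R) : (4 <= n)%nat ->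
  growth n * (exp (a / 2) - 1) ^ 2 + growth n / (INR n + 1) * (exp b - 1) ^ 2
  <= entropy n a b.
Proof.
intros Hn. destruct (growth_bounds n Hn) as [HN [Hal Hbe]].
set (al := growth n) in *. unfold entropy. fold al.
rewrite exp_INR_S_mult, exp_INR_mult.
assert (HF := entropy_ge_sq a).
assert (HG := power_gap_ge_sq (exp b) n (Rlt_le _ _ (exp_pos b))).
assert (HG' : (exp b - 1) ^ 2 <= INR n * exp b ^ S n - (INR n + 1) * exp b ^ n + 1)
  by (apply HG; lia).
apply Rplus_le_compat.
- assert (H0 := pow2_ge_0 (exp (a / 2) - 1)).
  apply Rmult_le_compat; lra.
- replace (al * (INR n / (INR n + 1) * (exp b ^ S n - 1) - (exp b ^ n - 1)))
    with (al / (INR n + 1) * (INR n * exp b ^ S n - (INR n + 1) * exp b ^ n + 1))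
    by (field; lra).
  apply Rmult_le_compat_l; trivial. apply Rdiv_le_0_compat; lra.
Qed.

Lemma Rabs_le_sqrt_exp (u M c s : R) : 0 <= M ->
  u ^ 2 <= M * exp (- (2 * c * s)) -> Rabs u <= sqrt M * exp (- (c * s)).
Proof.
intros HM H.
assert (Hp := exp_pos (- (c * s))).
rewrite <- (sqrt_pow2 (sqrt M * exp (- (c * s)))).
- rewrite <- sqrt_Rsqr_abs. apply sqrt_le_1_alt.
  rewrite Rpow_mult_distr, pow2_sqrt by trivial.
  replace (exp (- (c * s)) ^ 2) with (exp (- (2 * c * s))).
  unfold Rsqr. lra.
  simpl. rewrite Rmult_1_r, <- exp_plus. f_equal. ring.
- apply Rmult_le_pos; [apply sqrt_pos|lra].
Qed.

(** The rate [al/2] is not optimal, but any exponential rate makes the nonlinear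
remainder an integrable perturbation of the linearized system. *)
Lemma log_profile_exp_decay (n : nat) (a b : R -> R) :
  (4 <= n)%nat -> log_profile_system n a b ->
  exists C s0, 0 <= C /\ forall s, s0 <= s ->
    Rabs (a s) <= C * exp (- (growth n / 2 * s)) /\
    Rabs (b s) <= C * exp (- (growth n / 2 * s)).
Proof.
intros Hn Hsys. destruct (growth_bounds n Hn) as [HN [Hal _]].
pose (V := fun s => entropy n (a s) (b s)).
assert (Hder : forall s, is_derive V s (Derive V s) /\ Derive V s <= - growth n * V s).
{ intros s. destruct (entropy_dissipation n a b s Hn Hsys) as [dV [H1 H2]].
  assert (E : Derive V s = dV) by (apply is_derive_unique; exact H1).
  rewrite E. split; trivial. }
assert (Hlow : forall s, growth n * (exp (a s / 2) - 1) ^ 2 <= V s /\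
                 growth n / (INR n + 1) * (exp (b s) - 1) ^ 2 <= V s).
{ intros s. assert (H := entropy_ge_sqs n (a s) (b s) Hn). unfold V.
  assert (0 <= growth n * (exp (a s / 2) - 1) ^ 2)
    by (apply Rmult_le_pos; [lra|apply pow2_ge_0]).
  assert (0 <= growth n / (INR n + 1) * (exp (b s) - 1) ^ 2)
    by (apply Rmult_le_pos; [apply Rdiv_le_0_compat; lra|apply pow2_ge_0]).
  lra. }
destruct (perturbed_gronwall V (Derive V) (growth n) 0 1 0) as [M [HM HV]]; try lra.
- intros s _. apply Hder.
- intros s _. destruct (Hlow s) as [H _].
  apply Rle_trans with (2 := H). apply Rmult_le_pos; [lra|apply pow2_ge_0].
- intros s _. destruct (Hder s) as [_ H]. lra.
(* [M'] absorbs the coercivity constants; past [s1] both exponentials are within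
   1/2 of 1, where the logarithm can be controlled. *)
- pose (M' := (INR n + 1) / growth n * M).
  assert (Hratio : 1 <= (INR n + 1) / growth n).
  { apply Rmult_le_reg_r with (growth n); [lra|].
    unfold Rdiv. rewrite Rmult_assoc, Rinv_l; lra. }
  assert (HM' : 0 <= M') by (apply Rmult_le_pos; lra).
  destruct (eventually_exp_decay_le M' (growth n) (1 / 4)) as [s1 Hs1]; try lra.
  (* 16 comes from [(a/2)^2 <= 4 (e^(a/2) - 1)^2]. *)
  exists (sqrt (16 * M')), (Rmax 0 s1). split; [apply sqrt_pos|].
  intros s Hs.
  assert (Hs0 : 0 <= s) by (apply Rle_trans with (2 := Hs); apply Rmax_l).
  assert (Hs1' : s1 <= s) by (apply Rle_trans with (2 := Hs); apply Rmax_r).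
  specialize (HV s Hs0). specialize (Hs1 s Hs1').
  destruct (Hlow s) as [H1 H2].
  assert (He := exp_pos (- (growth n * s))).
  set (e := exp (- (growth n * s))) in *.
  assert (Ha : (exp (a s / 2) - 1) ^ 2 <= M' * e).
  { apply Rmult_le_reg_l with (growth n); [lra|].
    replace (growth n * (M' * e)) with ((INR n + 1) * (M * e)) by (unfold M'; field; lra).
    assert (0 <= M * e) by (apply Rmult_le_pos; lra). nra. }
  assert (Hb : (exp (b s) - 1) ^ 2 <= M' * e).
  { apply Rmult_le_reg_l with (growth n / (INR n + 1)).
    apply Rdiv_lt_0_compat; lra.
    replace (growth n / (INR n + 1) * (M' * e)) with (M * e) by (unfold M'; field; lra).
    lra. }
  assert (Ha' := sq_le_of_exp_near_1 (a s / 2) ltac:(lra)).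
  assert (Hb' := sq_le_of_exp_near_1 (b s) ltac:(lra)).
  split; apply Rabs_le_sqrt_exp; try lra;
    replace (2 * (growth n / 2) * s) with (growth n * s) by field; fold e.
  + lra.
  + assert (0 <= M' * e) by (apply Rmult_le_pos; lra). lra.
Qed.

(** The discriminant of [X^2 - n X + k], [k = 2n(n-1)/(n+1)], is
[n/(n+1)] times this number. *)
Lemma no_resonance (n : nat) : (4 <= n)%nat -> INR n ^ 2 - 7 * INR n + 8 <> 0.
Proof.
intros Hn.
destruct (Nat.eq_dec n 4) as [->|H4]; [simpl; lra|].
destruct (Nat.eq_dec n 5) as [->|H5]; [simpl; lra|].
assert (H6 : (6 <= n)%nat) by lia. apply le_INR in H6.
replace (INR 6) with 6 in H6 by (simpl; lra). nra.
Qed.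

(** In the variables [a] and [d = al (b - a)] the system is a damped oscillator
with stiffness [(n-1) al] up to errors built from [e^u - 1 - u]; one factor [u] of
the quadratic error is exponentially small by [log_profile_exp_decay]. *)
Lemma log_profile_sharp_decay (n : nat) (a b : R -> R) :
  (4 <= n)%nat -> log_profile_system n a b ->
  exists C s0, forall s, s0 <= s ->
    Rabs (a s) <= C * exp (- (slow_rate (INR n) ((INR n - 1) * growth n) * s)).
Proof.
intros Hn Hsys. destruct (growth_bounds n Hn) as [HN [Hal _]].
destruct (log_profile_exp_decay n a b Hn Hsys) as [C [s0 [HC Hdec]]].
destruct (eventually_exp_decay_le C (growth n / 2) (1 / (2 * (INR n + 1)))) as [s1 Hs1];
  [lra|lra|apply Rdiv_lt_0_compat; lra|].
assert (Hal1 : (INR n + 1) * (growth n - 1) = INR n - 1) by (unfold growth; field; lra).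
set (al := growth n) in *.
pose (d := fun s => al * (b s - a s)).
pose (q := fun u => exp u - 1 - u).
pose (E1 := fun s => al * q (b s - a s)).
pose (E2 := fun s => al * ((al - 1) * q (- a s - INR n * b s) - al * q (b s - a s))).
assert (Hq : forall s, Rmax s0 s1 <= s ->
  Rabs (q (b s - a s)) <= 2 * (INR n + 1) ^ 2 * C * exp (- (al / 2 * s)) * (Rabs (a s) + Rabs (d s)) /\
  Rabs (q (- a s - INR n * b s)) <= 2 * (INR n + 1) ^ 2 * C * exp (- (al / 2 * s)) * (Rabs (a s) + Rabs (d s))).
{ intros s Hs.
  assert (Hs0 : s0 <= s) by (apply Rle_trans with (2 := Hs); apply Rmax_l).
  assert (Hs1' : s1 <= s) by (apply Rle_trans with (2 := Hs); apply Rmax_r).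
  specialize (Hs1 s Hs1'). destruct (Hdec s Hs0) as [H1 H2].
  set (ee := C * exp (- (al / 2 * s))) in *.
  assert (Hee : (INR n + 1) * ee <= 1 / 2).
  { apply Rmult_le_compat_l with (r := INR n + 1) in Hs1; [|lra].
    replace ((INR n + 1) * (1 / (2 * (INR n + 1)))) with (1 / 2) in Hs1 by (field; lra).
    exact Hs1. }
  assert (Hpa := Rabs_pos (a s)). assert (Hpb := Rabs_pos (b s)). assert (Hpd := Rabs_pos (d s)).
  assert (Hbd : Rabs (b s) <= Rabs (a s) + Rabs (d s)).
  { replace (b s) with (a s + d s / al) by (unfold d; field; lra).
    apply Rle_trans with (1 := Rabs_triang _ _).
    apply Rplus_le_compat_l. unfold Rdiv. rewrite Rabs_mult.
    rewrite <- (Rmult_1_r (Rabs (d s))) at 2. apply Rmult_le_compat_l; trivial.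
    rewrite Rabs_right. rewrite <- Rinv_1. apply Rinv_le_contravar; lra.
    apply Rle_ge, Rlt_le, Rinv_0_lt_compat; lra. }
  (* [u^2 = |u| |u|]: one factor is small, the other is linear in [a, d]. *)
  assert (Hmain : forall u, Rabs u <= Rabs (a s) + INR n * Rabs (b s) ->
    Rabs (q u) <= 2 * (INR n + 1) ^ 2 * C * exp (- (al / 2 * s)) * (Rabs (a s) + Rabs (d s))).
  { intros u Hu.
    assert (Hu1 : Rabs u <= (INR n + 1) * ee) by nra.
    assert (Hu2 : Rabs u <= (INR n + 1) * (Rabs (a s) + Rabs (d s))) by nra.
    apply Rle_trans with (2 * u ^ 2).
    - apply exp_taylor1_error. lra.
    - rewrite <- pow2_abs.
      replace (2 * (INR n + 1) ^ 2 * C * exp (- (al / 2 * s)) * (Rabs (a s) + Rabs (d s)))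
        with (2 * (((INR n + 1) * ee) * ((INR n + 1) * (Rabs (a s) + Rabs (d s)))))
        by (unfold ee; ring).
      apply Rmult_le_compat_l; [lra|]. simpl. rewrite Rmult_1_r.
      apply Rmult_le_compat; trivial; apply Rabs_pos. }
  split; apply Hmain; unfold Rminus; apply Rle_trans with (1 := Rabs_triang _ _);
    rewrite !Rabs_Ropp; try rewrite Rabs_mult, (Rabs_right (INR n)) by lra; nra. }
(* Since [1 < al < 2], both errors are at most [al (al - 1 + al) <= 8] times the
   bound just proved. *)
destruct (damped_oscillator_decay (INR n) ((INR n - 1) * al)
  (8 * (2 * (INR n + 1) ^ 2 * C)) (al / 2) (Rmax s0 s1) a d E1 E2) as [M [HM Ha]].
- intros E.
  assert (E' : INR n * (INR n ^ 2 - 7 * INR n + 8) = 0).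
  { replace (INR n * (INR n ^ 2 - 7 * INR n + 8))
      with ((INR n + 1) * (INR n ^ 2 - 4 * ((INR n - 1) * al)))
      by (unfold al, growth; field; lra).
    rewrite E. ring. }
  apply no_resonance in Hn. apply Rmult_integral in E'. lra.
- apply Rmult_le_pos; [lra|]. apply Rmult_le_pos; trivial. 
  apply Rmult_le_pos; [lra|apply pow2_ge_0].
- lra.
- intros s _. destruct (Hsys s) as [Ha _]. fold al in Ha.
  replace (d s + E1 s) with (al * (exp (b s - a s) - 1)); trivial.
  unfold d, E1, q. ring.
- intros s _. destruct (Hsys s) as [Ha Hb]. fold al in Ha, Hb.
  unfold d at 1. auto_derive.
  + split; [eexists; exact Hb|]. split; [eexists; exact Ha|trivial].
  + replace (Derive (fun x => a x) s) with (al * (exp (b s - a s) - 1))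
      by (symmetry; apply is_derive_unique; exact Ha).
    replace (Derive (fun x => b x) s)
      with ((al - 1) * (exp (- a s - INR n * b s) - 1))
      by (symmetry; apply is_derive_unique; exact Hb).
    unfold E2, q, d.
    set (e1 := exp (b s - a s)). set (e2 := exp (- a s - INR n * b s)).
    unfold al, growth. field. lra.
- intros s Hs. destruct (Hq s Hs) as [H1 _]. unfold E1. rewrite Rabs_mult, (Rabs_right al) by lra.
  set (T := 2 * (INR n + 1) ^ 2 * C * exp (- (al / 2 * s)) * (Rabs (a s) + Rabs (d s))) in *.
  assert (HT := Rabs_pos (q (b s - a s))).
  apply Rle_trans with (8 * T); [nra|]. right; unfold T; ring.
- intros s Hs. destruct (Hq s Hs) as [H1 H2]. unfold E2.
  set (T := 2 * (INR n + 1) ^ 2 * C * exp (- (al / 2 * s)) * (Rabs (a s) + Rabs (d s))) in *.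
  apply Rle_trans with (8 * T); [|right; unfold T; ring].
  apply Rabs_le_between in H1. apply Rabs_le_between in H2.
  assert (HT : 0 <= T) by lra.
  set (q1 := q (b s - a s)) in *. set (q2 := q (- a s - INR n * b s)) in *.
  assert (HX : Rabs ((al - 1) * q2 - al * q1) <= 3 * T).
  { apply Rabs_le. split; nra. }
  rewrite Rabs_mult, (Rabs_right al) by lra.
  assert (H3 := Rabs_pos ((al - 1) * q2 - al * q1)). nra.
- exists (sqrt M), (Rmax s0 s1). intros s Hs.
  apply Rabs_le_sqrt_exp; trivial. apply Ha; trivial.
Qed.

(** * From the radial profile to the logarithmic system *)

Lemma is_derive_of_D_in (f f1 : R -> R) (r : R) :
  0 < r -> D_in f f1 halfline r -> is_derive f r (f1 r).
Proof.
intros Hr H. apply is_derive_Reals. intros eps He.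
destruct (H eps He) as [del [Hdel Hlim]].
assert (Hm : 0 < Rmin del r) by (apply Rmin_pos; lra).
exists (mkposreal _ Hm). intros h Hh Hhm. simpl in Hhm.
assert (H1 := Rmin_l del r). assert (H2 := Rmin_r del r).
specialize (Hlim (r + h)). simpl in Hlim. unfold Rdist in Hlim.
replace (r + h - r) with h in Hlim by ring.
apply Hlim. split; [|lra].
apply Rabs_lt_between in Hhm. split; [unfold halfline; lra|].
intros E. apply Hh. lra.
Qed.

(** The integrand of the profile equation is controlled on [0, oo) only; composing with
the absolute value makes it continuous on the line without changing its
integrals over [0, r]. *)
Lemma continuous_even_extension (f f1 : R -> R) :
  (forall r, 0 <= r -> D_in f f1 halfline r) ->
  forall s, continuous (fun t => f (Rabs t)) s.
Proof.
intros H s. apply continuity_pt_filterlim.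
assert (Hc : continue_in f halfline (Rabs s))
  by (eapply cont_deriv; apply H; apply Rabs_pos).
intros eps He. destruct (Hc eps He) as [del [Hdel Hlim]].
exists del. split; trivial. intros t [_ Ht].
simpl in *. unfold Rdist in *.
destruct (Req_dec (Rabs s) (Rabs t)) as [E|E].
- rewrite E. rewrite Rminus_diag, Rabs_R0. exact He.
- apply Hlim. split.
  + split; trivial. unfold halfline; apply Rabs_pos.
  + apply Rle_lt_trans with (2 := Ht). apply Rabs_triang_inv2.
Qed.

Lemma derive_nonneg_of_monotone (f : R -> R) (r l : R) :
  0 < r -> (forall x y, 0 <= x -> x <= y -> f x <= f y) ->
  is_derive f r l -> 0 <= l.
Proof.
intros Hr Hmono H. apply is_derive_Reals in H.
apply Rnot_lt_le. intros Hl.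
destruct (H (- l)) as [del Hd]; [lra|].
assert (Hp := cond_pos del).
specialize (Hd (del / 2)). rewrite (Rabs_right (del / 2)) in Hd by lra.
specialize (Hd ltac:(lra) ltac:(lra)).
apply Rabs_lt_between in Hd.
assert (0 <= (f (r + del / 2) - f r) / (del / 2)).
{ apply Rdiv_le_0_compat; [|lra].
  assert (f r <= f (r + del / 2)) by (apply Hmono; lra). lra. }
lra.
Qed.

(** Differentiating the integral equation gives
[phi phi'^(n-1) phi'' = r^(n-1)]; dividing requires [phi' > 0], which holds since
[phi' >= 0] and [phi'^n] is the integral of a positive function. *)
Lemma radial_profile_ode (n : nat) (phi : R -> R) :
  (1 <= n)%nat -> radial_profile n phi ->
  exists phi1 : R -> R, forall r, 0 < r ->
    0 < phi r /\ 0 < phi1 r /\ is_derive phi r (phi1 r) /\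
    is_derive phi1 r (r ^ (n - 1) / (phi r * phi1 r ^ (n - 1))).
Proof.
intros Hn [H0 [Hmono [phi1 [phi2 [HC Hint]]]]].
exists phi1.
assert (Hphi : forall r, 0 <= r -> 0 < phi r).
{ intros r Hr. assert (H := Hmono 0 r (Rle_refl 0) Hr). lra. }
pose (g := fun s => s ^ (n - 1) / phi (Rabs s)).
assert (Hg : forall s, continuous g s).
{ intros s. unfold g, Rdiv.
  apply (continuous_mult (fun s => s ^ (n - 1)) (fun s => / phi (Rabs s))).
  - apply (ex_derive_continuous (fun s => s ^ (n - 1)) s). auto_derive. trivial.
  - apply (continuous_comp (fun t => phi (Rabs t)) Rinv).
    + apply (continuous_even_extension phi phi1). intros r Hr. apply (HC r Hr).
    + apply continuous_Rinv. apply Rgt_not_eq, Hphi, Rabs_pos. }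
assert (Hpow : forall r, 0 < r -> phi1 r ^ n = INR n * RInt g 0 r).
{ intros r Hr. rewrite (Hint r Hr). f_equal. apply RInt_ext.
  intros x Hx. rewrite Rmin_left, Rmax_right in Hx by lra.
  unfold g. rewrite Rabs_right by lra. reflexivity. }
assert (Hd : forall r, 0 < r -> is_derive phi r (phi1 r)).
{ intros r Hr. apply is_derive_of_D_in; trivial. apply (HC r). lra. }
assert (Hd1 : forall r, 0 < r -> is_derive phi1 r (phi2 r)).
{ intros r Hr. apply is_derive_of_D_in; trivial. apply (HC r). lra. }
assert (HN : 0 < INR n) by (apply lt_0_INR; lia).
assert (Hpos : forall r, 0 < r -> 0 < phi1 r).
{ intros r Hr.
  assert (Hge := derive_nonneg_of_monotone phi r _ Hr Hmono (Hd r Hr)).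
  destruct Hge as [Hgt|Heq]; trivial. exfalso.
  assert (H := Hpow r Hr). rewrite <- Heq, pow_i in H by lia.
  assert (Hi : 0 < RInt g 0 r).
  { apply RInt_gt_0; trivial.
    intros x Hx. unfold g. apply Rdiv_lt_0_compat.
    apply pow_lt; lra. apply Hphi, Rabs_pos. }
  nra. }
intros r Hr. split; [apply Hphi; lra|]. split; [auto|]. split; [auto|].
assert (Hi : is_derive (fun x => phi1 x ^ n) r (INR n * g r)).
{ apply (is_derive_ext_loc (fun x => INR n * RInt g 0 x)).
  - exists (mkposreal r Hr). intros x Hx.
    apply Rabs_lt_between in Hx. simpl in Hx.
    unfold minus, plus, opp in Hx; simpl in Hx. symmetry. apply Hpow. lra.
  - apply (is_derive_scal (fun x => RInt g 0 x) r (INR n)).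
    apply (is_derive_RInt g (fun x => RInt g 0 x) 0 r).
    + exists (mkposreal r Hr). intros x _. apply (RInt_correct (V := R_CompleteNormedModule)).
      apply (ex_RInt_continuous (V := R_CompleteNormedModule)). intros z _. apply Hg.
    + apply Hg. }
assert (Hi' : is_derive (fun x => phi1 x ^ n) r (INR n * phi2 r * phi1 r ^ pred n)).
{ apply is_derive_pow. auto. }
assert (E := is_derive_unique _ _ _ Hi).
rewrite (is_derive_unique _ _ _ Hi') in E.
replace (r ^ (n - 1) / (phi r * phi1 r ^ (n - 1))) with (phi2 r).
auto.
assert (Hp : 0 < phi1 r ^ (n - 1)) by (apply pow_lt; auto).
assert (Hpr : 0 < phi r) by (apply Hphi; lra).
replace (pred n) with (n - 1)%nat in E by lia.
unfold g in E. rewrite Rabs_right in E by lra.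
assert (E' : phi2 r * phi1 r ^ (n - 1) = r ^ (n - 1) / phi r).
{ apply Rmult_eq_reg_l with (INR n); lra. }
replace (r ^ (n - 1) / (phi r * phi1 r ^ (n - 1)))
  with (r ^ (n - 1) / phi r / phi1 r ^ (n - 1)) by (field; lra).
rewrite <- E'. field. lra.
Qed.

(** The condition [c^(n+1) al^n (al-1) = 1] for [c r^al] to solve
[phi phi'^(n-1) phi'' = r^(n-1)]. *)
Lemma leading_coef_log_relation (n : nat) : (4 <= n)%nat ->
  0 < leading_coef n /\
  (INR n + 1) * ln (leading_coef n) + INR n * ln (growth n) + ln (growth n - 1) = 0.
Proof.
intros Hn. destruct (growth_bounds n Hn) as [HN _].
assert (P1 : 0 < Rpower (2 * INR n) (INR n / (INR n + 1))) by apply exp_pos.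
assert (P2 : 0 < Rpower (INR n - 1) (1 / (INR n + 1))) by apply exp_pos.
split.
- apply Rdiv_lt_0_compat; [lra|]. apply Rmult_lt_0_compat; trivial.
- replace (growth n - 1) with ((INR n - 1) / (INR n + 1)) by (unfold growth; field; lra).
  unfold leading_coef, growth.
  rewrite !ln_div; try lra; [|apply Rmult_lt_0_compat; trivial].
  rewrite (ln_mult _ _ P1 P2). unfold Rpower at 1 2. rewrite !ln_exp.
  field. lra.
Qed.

(** The system is autonomous because the powers of [r] balance:
[al + n (al-1) = n]. *)
Lemma log_profile_system_of_radial (n : nat) (phi : R -> R) :
  (4 <= n)%nat -> radial_profile n phi ->
  exists a b : R -> R, log_profile_system n a b /\
    forall r, 0 < r ->
      phi r = leading_coef n * Rpower r (growth n) * exp (a (ln r)).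
Proof.
intros Hn Hphi.
destruct (growth_bounds n Hn) as [HN [Hal _]].
destruct (leading_coef_log_relation n Hn) as [Hc Hrel].
destruct (radial_profile_ode n phi ltac:(lia) Hphi) as [phi1 Hode].
assert (Hgr : growth n + INR n * (growth n - 1) = INR n) by (unfold growth; field; lra).
set (al := growth n) in *. set (lc := ln (leading_coef n)) in *.
exists (fun s => ln (phi (exp s)) - al * s - lc).
exists (fun s => ln (phi1 (exp s)) - (al - 1) * s - ln al - lc).
split.
- intros s. destruct (Hode (exp s) (exp_pos s)) as [Hp [Hp1 [Hd Hd1]]].
  fold al. split.
  + auto_derive.
    * split; [eexists; exact Hd|]. split; trivial.
    * replace (Derive (fun x => phi x) (exp s)) with (phi1 (exp s))
        by (symmetry; apply is_derive_unique; exact Hd).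
      replace (ln (phi1 (exp s)) - (al - 1) * s - ln al - lc - (ln (phi (exp s)) - al * s - lc))
        with (ln (phi1 (exp s)) + s + - ln al + - ln (phi (exp s))) by ring.
      rewrite !exp_plus, !exp_Ropp, !exp_ln by lra. field. lra.
  + auto_derive.
    * split; [eexists; exact Hd1|]. split; trivial.
    * replace (Derive (fun x => phi1 x) (exp s))
        with (exp s ^ (n - 1) / (phi (exp s) * phi1 (exp s) ^ (n - 1)))
        by (symmetry; apply is_derive_unique; exact Hd1).
      set (p := phi (exp s)) in *. set (q := phi1 (exp s)) in *.
      replace (- (ln p - al * s - lc) - INR n * (ln q - (al - 1) * s - ln al - lc))
        with (INR n * s + - ln p + - (INR n * ln q) + - ln (al - 1)).
      2:{ replace (INR n * s) with ((al + INR n * (al - 1)) * s) by (rewrite Hgr; ring).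
          lra. }
      rewrite !exp_plus, !exp_Ropp, !exp_INR_mult, !exp_ln by lra.
      destruct n as [|m]; [lia|]. replace (S m - 1)%nat with m by lia.
      assert (0 < q ^ m) by (apply pow_lt; lra).
      simpl. field. repeat split; lra.
- intros r Hr. destruct (Hode r Hr) as [Hp _].
  rewrite exp_ln by trivial. unfold Rpower, Rminus.
  rewrite !exp_plus, !exp_Ropp. unfold lc. rewrite !exp_ln by trivial.
  assert (H := exp_pos (al * ln r)). field. lra.
Qed.

(** * The asymptotic expansion *)

(** One has [n^2/4 - k = (n/(n+1))^2 X], with [X] the radicand in
[decay_exponent]; for [n >= 4] it is negative exactly when [n = 4, 5], the two cases of the
definition. *)
Lemma decay_exponent_eq (n : nat) : (4 <= n)%nat ->
  decay_exponent n = slow_rate (INR n) ((INR n - 1) * growth n) - growth n /\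
  0 < decay_exponent n.
Proof.
intros Hn. destruct (growth_bounds n Hn) as [HN _].
unfold slow_rate.
assert (Hdisc : INR n ^ 2 / 4 - (INR n - 1) * growth n
  = (INR n / (INR n + 1)) ^ 2 * ((INR n - 3) ^ 2 / 4 - 2 * (INR n - 1) / INR n))
  by (unfold growth; field; lra).
rewrite Hdisc.
set (X := (INR n - 3) ^ 2 / 4 - 2 * (INR n - 1) / INR n).
assert (HX : 4 * INR n * X = INR n * (INR n - 3) ^ 2 - 8 * (INR n - 1))
  by (unfold X; field; lra).
assert (Hq : 0 < INR n / (INR n + 1)) by (apply Rdiv_lt_0_compat; lra).
unfold decay_exponent.
destruct (Nat.leb_spec n 5) as [H5|H6].
- rewrite sqrt_neg_0.
  + split; [unfold growth; field; lra|]. apply Rdiv_lt_0_compat; [apply Rmult_lt_0_compat|]; lra.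
  + assert (X <= 0); [|assert (0 < (INR n / (INR n + 1)) ^ 2) by (apply pow_lt; lra); nra].
    assert (n = 4 \/ n = 5)%nat as [-> | ->] by lia;
    simpl in HX; lra.
- assert (H6' : (6 <= n)%nat) by lia. apply le_INR in H6'.
  replace (INR 6) with 6 in H6' by (simpl; lra).
  assert (HX0 : 0 <= X).
  { assert (9 <= (INR n - 3) ^ 2) by nra.
    apply Rmult_le_reg_l with (4 * INR n); nra. }
  fold X.
  rewrite sqrt_mult by (trivial; apply pow2_ge_0).
  rewrite sqrt_pow2 by lra. split.
  + unfold growth. field. lra.
  + apply Rmult_lt_0_compat; trivial.
    assert (sqrt X < (INR n - 3) / 2); [|lra].
    rewrite <- (sqrt_pow2 ((INR n - 3) / 2)) by lra.
    apply sqrt_lt_1_alt. split; trivial. unfold X.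
    assert (0 < 2 * (INR n - 1) / INR n) by (apply Rdiv_lt_0_compat; lra). lra.
Qed.

Theorem theorem1p4 (n : nat) (hn : (4 <= n)%nat) :
  exists K : R,
    0 < K /\
    (forall phi : R -> R, radial_profile n phi ->
       bigO_at_infty
         (fun r => phi r - leading_coef n * Rpower r (2 * INR n / (INR n + 1)))
         (fun r => Rpower r (- K))) /\
    K = decay_exponent n.
Proof.
destruct (decay_exponent_eq n hn) as [HK HKpos].
exists (decay_exponent n). split; trivial. split; trivial.
intros phi Hphi.
destruct (growth_bounds n hn) as [HN [Hal _]].
destruct (leading_coef_log_relation n hn) as [Hc _].
destruct (log_profile_system_of_radial n phi hn Hphi) as [a [b [Hsys Heq]]].
destruct (log_profile_sharp_decay n a b hn Hsys) as [C [s0 Hdec]].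
set (lam := slow_rate (INR n) ((INR n - 1) * growth n)) in *.
destruct (eventually_exp_decay_le (Rabs C) lam (1 / 2)) as [s1 Hs1];
  [apply Rabs_pos|lra|lra|].
exists (2 * leading_coef n * C), (exp (Rmax s0 s1)).
intros r Hr.
assert (Hr0 : 0 < r) by (apply Rlt_trans with (2 := Hr); apply exp_pos).
assert (Hs : Rmax s0 s1 <= ln r).
{ rewrite <- (ln_exp (Rmax s0 s1)). left. apply ln_increasing; trivial. apply exp_pos. }
assert (H0 : s0 <= ln r) by (apply Rle_trans with (2 := Hs); apply Rmax_l).
assert (H1 : s1 <= ln r) by (apply Rle_trans with (2 := Hs); apply Rmax_r).
specialize (Hdec _ H0). specialize (Hs1 _ H1).
fold (growth n). rewrite (Heq r Hr0).
set (x := a (ln r)) in *.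
assert (Hsmall : Rabs x <= 1 / 2).
{ assert (H := RRle_abs C). assert (He := exp_pos (- (lam * ln r))). nra. }
assert (Hexp : Rabs (exp x - 1) <= 2 * Rabs x).
{ replace (exp x - 1) with ((exp x - 1 - x) + x) by ring.
  apply Rle_trans with (1 := Rabs_triang _ _).
  assert (H := exp_taylor1_error x Hsmall). rewrite <- (pow2_abs x) in H.
  assert (Hp := Rabs_pos x). nra. }
assert (Hg : 0 < Rpower r (growth n)) by apply exp_pos.
replace (leading_coef n * Rpower r (growth n) * exp x - leading_coef n * Rpower r (growth n))
  with (leading_coef n * Rpower r (growth n) * (exp x - 1)) by ring.
assert (HP : 0 < leading_coef n * Rpower r (growth n)) by (apply Rmult_lt_0_compat; trivial).
rewrite Rabs_mult, (Rabs_right (leading_coef n * Rpower r (growth n))) by lra.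
rewrite (Rabs_right (Rpower r (- decay_exponent n))) by (left; apply exp_pos).
replace (Rpower r (- decay_exponent n))
  with (Rpower r (growth n) * exp (- (lam * ln r))).
2:{ rewrite HK. unfold Rpower. rewrite <- exp_plus. f_equal. ring. }
apply Rle_trans with (leading_coef n * Rpower r (growth n) * (2 * (C * exp (- (lam * ln r))))).
- apply Rmult_le_compat_l; lra.
- right. ring.
Qed.
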